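(* Let $p\in\mathbb{N}$ and suppose: (1) $\mathbf{f}_1,\dots,\mathbf{f}_p$ are non-zero elements of $\ell^2(\Lambda,\mathcal{M}_n)$ such that $\{\mathcal{D}_{2N\lambda}\mathbf{f}_j\}_{\lambda\in\Lambda,\,1\le j\le p}$ is a matrix-valued DFNS for $\ell^2(\Lambda,\mathcal{M}_n)$ with (lower and upper) frame bounds $a_0$ and $b_0$; (2) $\mathbf{g}_1,\dots,\mathbf{g}_p$ are non-zero elements of $\ell^2(\Lambda,\mathcal{M}_n)$ and $\epsilon$ is a positive real number such that $$\left\|\mathcal{F}(\mathbf{f}_j+\mathbf{g}_j)(x)\right\|_{\mathcal{M}_n}\le\epsilon<2^{p-1}\epsilon^2n^2<a_0\quad\text{for every } j\in\{1,\dots,p\}\text{ and a.e. }x\in\Omega.$$ Then $\{\mathcal{D}_{2N\lambda}\mathbf{g}_j\}_{\lambda\in\Lambda,\,1\le j\le p}$ is also a matrix-valued DFNS for $\ell^2(\Lambda,\mathcal{M}_n)$, with lower frame bound $\big(\sqrt{a_0}-\sqrt{2^{p-1}\epsilon^2n^2}\big)^2$ and upper frame bound $2^p\epsilon^2n^2+2b_0$.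
   Context: Fix $n,N\in\mathbb{N}$ (positive integers) and an odd integer $r$ coprime to $N$ with $1\le r\le 2N-1$. Put $\Lambda=\{0,\frac{r}{N}\}+2\mathbb{Z}\subset\mathbb{R}$ and $\Omega=[0,\frac12)\cup[\frac N2,\frac{N+1}{2})$. $\mathcal{M}_n$ is the space of complex $n\times n$ matrices with norm $\|\mathbf{a}\|_{\mathcal{M}_n}=\big(\sum_{m,k=1}^n|a_{m,k}|^2\big)^{1/2}$. $\ell^2(\Lambda,\mathcal{M}_n)$ is the Hilbert space of maps $\mathbf{f}:\Lambda\to\mathcal{M}_n$ with $\sum_{\lambda\in\Lambda}\sum_{m,k=1}^n|f_{m,k}(\lambda)|^2<\infty$, with inner product $\langle\mathbf{f},\mathbf{g}\rangle=\sum_{\lambda\in\Lambda}\sum_{m,k=1}^n f_{m,k}(\lambda)\overline{g_{m,k}(\lambda)}$ and associated norm $\|\cdot\|_{\ell^2}$. $L^2(\Omega,\mathcal{M}_n)$ is the Hilbert space of $\mathcal{M}_n$-valued functions on $\Omega$ with entries in $L^2(\Omega)$ and inner product $\sum_{m,k}\int_\Omega F_{m,k}(x)\overline{G_{m,k}(x)}\,dx$. The Fourier transform $\mathcal{F}:\ell^2(\Lambda,\mathcal{M}_n)\to L^2(\Omega,\mathcal{M}_n)$ is defined entrywise by $\mathcal{F}(\mathbf{f})_{m,k}(x)=\sum_{\lambda\in\Lambda}f_{m,k}(\lambda)e^{2\pi i\lambda x}$ (convergence in $L^2(\Omega)$; $\{e^{2\pi i\lambda\cdot}\}_{\lambda\in\Lambda}$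 is a complete orthonormal system of $L^2(\Omega)$). For $\lambda\in\Lambda$, the displacement operator $\mathcal{D}_{2N\lambda}$ on $\ell^2(\Lambda,\mathcal{M}_n)$ is $(\mathcal{D}_{2N\lambda}\mathbf{f})(\lambda')=\mathbf{f}(\lambda'-2N\lambda)$, $\lambda'\in\Lambda$. For non-zero $\mathbf{f}_1,\dots,\mathbf{f}_p\in\ell^2(\Lambda,\mathcal{M}_n)$, the collection $\{\mathcal{D}_{2N\lambda}\mathbf{f}_j\}_{\lambda\in\Lambda,\,1\le j\le p}$ is a matrix-valued discrete frame of non-uniform shifts (matrix-valued DFNS) for $\ell^2(\Lambda,\mathcal{M}_n)$ with lower frame bound $a\in(0,\infty)$ and upper frame bound $b\in(0,\infty)$ if $a\|\mathbf{f}\|_{\ell^2}^2\le\sum_{j=1}^p\sum_{\lambda\in\Lambda}|\langle\mathbf{f},\mathcal{D}_{2N\lambda}\mathbf{f}_j\rangle|^2\le b\|\mathbf{f}\|_{\ell^2}^2$ for all $\mathbf{f}\in\ell^2(\Lambda,\mathcal{M}_n)$. (Frame bounds are not unique.) *)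

(* Defs.v *)
From mathcomp Require Import all_boot all_order all_algebra.
From mathcomp Require Import complex.
From mathcomp Require Import all_classical all_reals all_analysis.

Set Implicit Arguments.
Unset Strict Implicit.
Unset Printing Implicit Defensive.

Import Order.TTheory GRing.Theory Num.Theory.
Import numFieldNormedType.Exports.

Local Open Scope classical_set_scope.
Local Open Scope ring_scope.

Section Definitions.
Variable R : realType.

(* Modulus of a complex number as an element of R (`|z| lives in R[i]). *)
Definition cmod (z : R[i]) : R := ComplexField.Normc.normc z.

(* e^{2 pi i t} *)
Definition cexp2pi (t : R) : R[i] :=
  Complex (cos (2 * pi * t)) (sin (2 * pi * t)).

(* Sum of an absolutely summable family indexed by a set: \esum is meaningful
   for nonnegative families only, hence the positive and negative parts. *)
Definition rsum (T : choiceType) (D : set T) (u : T -> R) : R :=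
  fine (\esum_(t in D) (EFin \o u)^\+%E t)
  - fine (\esum_(t in D) (EFin \o u)^\-%E t).

Definition csum (T : choiceType) (D : set T) (u : T -> R[i]) : R[i] :=
  Complex (rsum D (fun t => complex.Re (u t)))
          (rsum D (fun t => complex.Im (u t))).

Definition Lambda (N r : nat) : set R :=
  [set c + 2 * z%:~R | c in [set 0; r%:R / N%:R] & z in [set: int]].

Definition Omega (N : nat) : set R :=
  `[0, 1 / 2[ `|` `[N%:R / 2, (N%:R + 1) / 2[.

Section Matrices.
Variable n : nat.

Definition mxnorm (a : 'M[R[i]]_n) : R :=
  Num.sqrt (\sum_(m < n) \sum_(k < n) cmod (a m k) ^+ 2).

Section Sequences.
Variables N r : nat.

(* A map from Lambda to matrices is represented by its extension by 0 to R. *)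
Definition ell2 (f : R -> 'M[R[i]]_n) : Prop :=
  (forall l, ~ Lambda N r l -> f l = 0) /\
  (\esum_(l in Lambda N r)
     (\sum_(m < n) \sum_(k < n) cmod (f l m k) ^+ 2)%:E < +oo)%E.

Definition ell2_inner (f g : R -> 'M[R[i]]_n) : R[i] :=
  csum (Lambda N r)
    (fun l => \sum_(m < n) \sum_(k < n) f l m k * conjc (g l m k)).

(* The inner product of f with itself is real and nonnegative. *)
Definition ell2_norm (f : R -> 'M[R[i]]_n) : R :=
  Num.sqrt (complex.Re (ell2_inner f f)).

(* D_{2 N l}.  Lambda is stable under translation by 2 N l when l is in Lambda,
   so this operator preserves the vanishing outside Lambda. *)
Definition displacement (l : R) (f : R -> 'M[R[i]]_n) : R -> 'M[R[i]]_n :=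
  fun l' => f (l' - 2 * N%:R * l).

Definition in_L2 (F : R -> 'M[R[i]]_n) : Prop :=
  forall m k : 'I_n,
    [/\ measurable_fun (Omega N) (fun x => complex.Re (F x m k)),
        measurable_fun (Omega N) (fun x => complex.Im (F x m k)) &
        (\int[lebesgue_measure]_(x in Omega N) (cmod (F x m k) ^+ 2)%:E
           < +oo)%E].

(* F is a representative of the Fourier transform of f, an element of L^2,
   i.e. a class of functions modulo a.e. equality on Omega: each entry of F is
   the limit in L^2(Omega), along the finite subsets of Lambda, of the
   exponential sums of the corresponding entry of f. *)
Definition is_fourier (f F : R -> 'M[R[i]]_n) : Prop :=
  in_L2 F /\
  forall (m k : 'I_n) (e : R), 0 < e ->
    exists2 A0 : set R, fsets (Lambda N r) A0 &
      forall A : set R, fsets (Lambda N r) A -> A0 `<=` A ->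
        (\int[lebesgue_measure]_(x in Omega N)
           (cmod ((\sum_(l \in A) f l m k * cexp2pi (l * x)) - F x m k)
              ^+ 2)%:E < e%:E)%E.

(* {D_{2 N l} f_j} is a matrix-valued discrete frame of non-uniform shifts with
   lower bound a and upper bound b (the f_j being nonzero members of ell2). *)
Definition is_DFNS (p : nat) (f : 'I_p -> R -> 'M[R[i]]_n) (a b : R) : Prop :=
  [/\ 0 < a, 0 < b &
    forall h : R -> 'M[R[i]]_n, ell2 h ->
      ((a * ell2_norm h ^+ 2)%:E <=
         \sum_(j < p) \esum_(l in Lambda N r)
           (cmod (ell2_inner h (displacement l (f j))) ^+ 2)%:E)%E /\
      (\sum_(j < p) \esum_(l in Lambda N r)
         (cmod (ell2_inner h (displacement l (f j))) ^+ 2)%:E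
         <= (b * ell2_norm h ^+ 2)%:E)%E].

End Sequences.
End Matrices.
End Definitions.

(* Main.v *)
Require Import Defs.
From mathcomp Require Import all_boot all_order all_algebra.
From mathcomp Require Import complex finmap ring lra.
From mathcomp Require Import all_classical all_reals all_analysis.
From mathcomp Require Import measurable_realfun.

Set Implicit Arguments.
Unset Strict Implicit.
Unset Printing Implicit Defensive.

Import Order.TTheory GRing.Theory Num.Theory.
Import numFieldNormedType.Exports.

Local Open Scope classical_set_scope.
Local Open Scope ring_scope.

(** Put phi_j = f_j + g_j and B = 2^(p-1) eps^2 n^2. The theorem rests on one
    estimate: when the Fourier transform of phi has norm at most eps almost
    everywhere on Omega, the displacements D_{2 N s} phi satisfy the Bessel
    inequality with bound eps^2 ([displacement_bessel]). Summed over j this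
    gives the bound p eps^2 <= B for the whole family (phi_j). Since
    g_j = phi_j - f_j, the frame coefficients of (g_j) are those of (phi_j)
    minus those of (f_j), and the triangle inequality in l^2 puts the square
    root of their square sum between (sqrt a0 - sqrt B) |h| and
    (sqrt b0 + sqrt B) |h|; the upper bound 2 B + 2 b0 is the weaker
    consequence (x + y)^2 <= 2 x^2 + 2 y^2. The triangle inequality is used in
    the form |x + y|^2 <= (1 + t) |x|^2 + (1 + 1/t) |y|^2, which passes through
    infinite sums without any discussion of finiteness ([sum_esum_sqD_le]); a
    suitable t recovers the sharp lower bound ([frame_lower_arith]).

    The Bessel inequality is dual to the bound
    |sum_s c_s D_{2 N s} phi|^2 <= eps^2 sum_s |c_s|^2 for finite sums
    ([synthesis_bound]). On the Fourier side the combination of displacements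
    is P Phi, where P is the trigonometric polynomial with coefficients c_s and
    frequencies 2 N s, so its norm is at most eps times the L^2 norm of P. The
    frequencies 2 N s are distinct elements of Lambda, and the exponentials
    with frequencies in Lambda are orthonormal in L^2(Omega) ([parseval]), so
    the square of that norm is sum_s |c_s|^2.

    The Fourier transform Phi is only known as an L^2 limit of trigonometric
    polynomials Phi_A over finite A in Lambda. Multiplication by the bounded
    function P preserves this limit ([multiplier_approx]), while for P Phi_A
    the passage from the function to its coefficients is a finite computation
    ([convolution_bessel]). *)

(** * Complex numbers and the Frobenius norm of matrices *)

Section ComplexNumbers.
Variable R : realType.
Implicit Types (z w : R[i]) (t : R).

Lemma cmod_sq z : cmod z ^+ 2 = complex.Re z ^+ 2 + complex.Im z ^+ 2.
Proof. by case: z => a b; rewrite /cmod /= sqr_sqrtr// addr_ge0// sqr_ge0. Qed.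

Lemma cmod_ge0 z : 0 <= cmod z.
Proof. by case: z => a b; rewrite /cmod /= sqrtr_ge0. Qed.

Lemma cmodM z w : cmod (z * w) = cmod z * cmod w.
Proof. exact: ComplexField.Normc.normcM. Qed.

Lemma cmodN z : cmod (- z) = cmod z.
Proof. exact: normcN. Qed.

Lemma le_cmodD z w : cmod (z + w) <= cmod z + cmod w.
Proof. exact: le_normcD. Qed.

Lemma cmod_conjc z : cmod (conjc z) = cmod z.
Proof. by case: z => a b; rewrite /cmod /= sqrrN. Qed.

Lemma cmod0 : cmod (0 : R[i]) = 0.
Proof. exact: ComplexField.Normc.normc0. Qed.

Lemma le_cmod_sum (I : Type) (s : seq I) (F : I -> R[i]) :
  cmod (\sum_(i <- s) F i) <= \sum_(i <- s) cmod (F i).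
Proof.
elim/big_ind2: _ => [|x1 x2 y1 y2 h1 h2|//]; first by rewrite cmod0.
exact: le_trans (le_cmodD _ _) (lerD h1 h2).
Qed.

Lemma le_abs_Re z : `|complex.Re z| <= cmod z.
Proof.
rewrite -(ger0_norm (cmod_ge0 z)) -ler_sqr ?nnegrE// !real_normK ?num_real//.
by rewrite cmod_sq lerDl sqr_ge0.
Qed.

Lemma le_abs_Im z : `|complex.Im z| <= cmod z.
Proof.
rewrite -(ger0_norm (cmod_ge0 z)) -ler_sqr ?nnegrE// !real_normK ?num_real//.
by rewrite cmod_sq lerDr sqr_ge0.
Qed.

Lemma le_cmod_Re_Im z : cmod z <= `|complex.Re z| + `|complex.Im z|.
Proof.
rewrite -ler_sqr ?nnegrE ?cmod_ge0 ?addr_ge0// cmod_sq.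
rewrite -(real_normK (num_real (complex.Re z))).
rewrite -(real_normK (num_real (complex.Im z))).
have := normr_ge0 (complex.Re z); have := normr_ge0 (complex.Im z).
by nra.
Qed.

Lemma ReD z w : complex.Re (z + w) = complex.Re z + complex.Re w.
Proof. by case: z w => [a b] [c d]. Qed.

Lemma ImD z w : complex.Im (z + w) = complex.Im z + complex.Im w.
Proof. by case: z w => [a b] [c d]. Qed.

Lemma Re_sum (I : Type) (s : seq I) (F : I -> R[i]) :
  complex.Re (\sum_(i <- s) F i) = \sum_(i <- s) complex.Re (F i).
Proof. by apply: (big_morph _ ReD). Qed.

Lemma Im_sum (I : Type) (s : seq I) (F : I -> R[i]) :
  complex.Im (\sum_(i <- s) F i) = \sum_(i <- s) complex.Im (F i).
Proof. by apply: (big_morph _ ImD). Qed.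

Lemma mul_conjc z : z * conjc z = Complex (cmod z ^+ 2) 0.
Proof.
by rewrite cmod_sq; case: z => a b /=; congr Complex; ring.
Qed.

Lemma cexp2piD s t : cexp2pi (s + t) = cexp2pi s * cexp2pi t :> R[i].
Proof.
by rewrite /cexp2pi mulrDr cosD sinD; congr Complex; rewrite addrC.
Qed.

Lemma cexp2pi_conj t : conjc (cexp2pi t) = cexp2pi (- t) :> R[i].
Proof. by rewrite /cexp2pi mulrN cosN sinN. Qed.

Lemma cmod_cexp2pi t : cmod (cexp2pi t) = 1 :> R.
Proof. by rewrite /cmod /= cos2Dsin2 sqrtr1. Qed.

(** The quadratic form of the triangle inequality: with t = |w| / |z| it is
    the square of |z + w| <= |z| + |w|, while being linear in the two squared
    moduli it can be integrated and summed as it stands. *)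
Lemma cmodD_sq_le t z w : 0 < t ->
  cmod (z + w) ^+ 2 <= (1 + t) * cmod z ^+ 2 + (1 + t^-1) * cmod w ^+ 2.
Proof.
move=> t0; rewrite !cmod_sq ReD ImD.
have key (a b : R) : (a + b) ^+ 2 <= (1 + t) * a ^+ 2 + (1 + t^-1) * b ^+ 2.
  rewrite -subr_ge0.
  rewrite (_ : _ - _ = t * (a - t^-1 * b) ^+ 2); last by field; rewrite gt_eqF.
  by rewrite mulr_ge0 ?sqr_ge0// ltW.
by have := lerD (key (complex.Re z) (complex.Re w))
               (key (complex.Im z) (complex.Im w)); lra.
Qed.

Section Matrices.
Variable n : nat.
Implicit Types a b : 'M[R[i]]_n.

Definition frobsq a : R := \sum_(m < n) \sum_(k < n) cmod (a m k) ^+ 2.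

Definition frobdot a b : R[i] :=
  \sum_(m < n) \sum_(k < n) a m k * conjc (b m k).

Lemma frobsq_ge0 a : 0 <= frobsq a.
Proof. by do 2!apply: sumr_ge0 => ? _; exact: sqr_ge0. Qed.

Lemma frobsqD_le a b : frobsq (a + b) <= 2 * frobsq a + 2 * frobsq b.
Proof.
rewrite /frobsq !mulr_sumr -big_split/=; apply: ler_sum => m _.
rewrite !mulr_sumr -big_split/=; apply: ler_sum => k _; rewrite mxE.
by have := @cmodD_sq_le 1 (a m k) (b m k) ltr01; rewrite invr1.
Qed.

Lemma frobdotDr a b b' : frobdot a (b + b') = frobdot a b + frobdot a b'.
Proof.
rewrite /frobdot -big_split/=; apply: eq_bigr => m _.
rewrite -big_split/=; apply: eq_bigr => k _.
by rewrite mxE rmorphD mulrDr.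
Qed.

Lemma frobdot_sumZr a (I : Type) (s : seq I) (c : I -> R[i])
    (b : I -> 'M[R[i]]_n) :
  frobdot a (\sum_(i <- s) c i *: b i) =
  \sum_(i <- s) conjc (c i) * frobdot a (b i).
Proof.
under [RHS]eq_bigr => i _.
  rewrite /frobdot mulr_sumr; under eq_bigr => m _ do rewrite mulr_sumr; over.
rewrite exchange_big/=; apply: eq_bigr => m _.
rewrite exchange_big/=; apply: eq_bigr => k _.
rewrite summxE rmorph_sum mulr_sumr; apply: eq_bigr => i _.
by rewrite mxE rmorphM; ring.
Qed.

Lemma Re_frobdot_self a : complex.Re (frobdot a a) = frobsq a.
Proof.
rewrite /frobdot Re_sum; apply: eq_bigr => m _; rewrite Re_sum.
by apply: eq_bigr => k _; rewrite mul_conjc.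
Qed.

(** Cauchy-Schwarz together with the arithmetic-geometric mean inequality. *)
Lemma Re_frobdot_le s a b : 0 < s ->
  2 * complex.Re (frobdot a b) <= s * frobsq a + s^-1 * frobsq b.
Proof.
move=> s0; rewrite /frobdot /frobsq Re_sum !mulr_sumr -big_split/=.
apply: ler_sum => m _; rewrite Re_sum !mulr_sumr -big_split/=.
apply: ler_sum => k _; rewrite !cmod_sq.
case: (a m k) (b m k) => [x y] [u v] /=.
have key (p q : R) : 2 * (p * q) <= s * p ^+ 2 + s^-1 * q ^+ 2.
  rewrite -subr_ge0.
  rewrite (_ : _ - _ = s * (p - s^-1 * q) ^+ 2); last by field; rewrite gt_eqF.
  by rewrite mulr_ge0 ?sqr_ge0// ltW.
by have := lerD (key x u) (key y v); lra.
Qed.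

Lemma cmod_frobdot_le a b : cmod (frobdot a b) <= frobsq a + frobsq b.
Proof.
apply: le_trans (le_cmod_sum _ _) _.
rewrite -big_split/=; apply: ler_sum => m _.
apply: le_trans (le_cmod_sum _ _) _.
rewrite -big_split/=; apply: ler_sum => k _.
rewrite cmodM cmod_conjc.
have := cmod_ge0 (a m k); have := cmod_ge0 (b m k); nra.
Qed.

End Matrices.
End ComplexNumbers.

(** * Unordered sums of real families *)

Section Summation.
Variables (R : realType) (T : choiceType) (D : set T).
Implicit Types (u v : T -> R) (A B : {fset T}).

Definition rsummable u := (\esum_(t in D) `|u t|%:E < +oo)%E.

Lemma fsbig_fset (V : nmodType) A (F : T -> V) :
  \sum_(t \in [set` A]) F t = \sum_(t <- A) F t.
Proof. by rewrite fsbig_finite ?set_fsetK//; exact: finite_fset. Qed.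

Lemma fset_sum_le_esum u A : [set` A] `<=` D ->
  ((\sum_(t <- A) u t)%:E <= \esum_(t in D) (u t)%:E)%E.
Proof.
move=> AD; apply: ereal_sup_ubound; exists [set` A].
  by split=> //; exact: finite_fset.
by rewrite fsbig_fset sumEFin.
Qed.

Lemma esum_le_fset u (c : \bar R) :
  (forall A, [set` A] `<=` D -> ((\sum_(t <- A) u t)%:E <= c)%E) ->
  (\esum_(t in D) (u t)%:E <= c)%E.
Proof.
move=> h; apply: ge_ereal_sup => _ [A [finA AD] <-].
rewrite fsbig_finite// sumEFin; apply: h.
by move=> t /=; rewrite in_fset_set// inE => /AD.
Qed.

Lemma ge0_esum_approx u (e : R) :
  (forall t, 0 <= u t) -> rsummable u -> 0 < e ->
  exists2 A0, [set` A0] `<=` D &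
    forall A, [set` A] `<=` D -> (A0 `<=` A)%fset ->
      `|fine (\esum_(t in D) (u t)%:E) - \sum_(t <- A) u t| <= e.
Proof.
move=> u0; rewrite /rsummable; under eq_esum do rewrite ger0_norm//.
move=> fin e0; have fn : (\esum_(t in D) (u t)%:E)%E \is a fin_num.
  by rewrite ge0_fin_numE// esum_ge0// => t _; rewrite lee_fin.
have [_ [A0 [finA0 A0D] <-] hA0] := ub_ereal_sup_adherent e0 fn.
rewrite -/(esum _ _) in hA0.
have A0D' : [set` fset_set A0] `<=` D.
  by move=> t /=; rewrite in_fset_set// inE => /A0D.
exists (fset_set A0) => // A AD A0A.
move: hA0; rewrite fsbig_finite//= sumEFin.
have := fset_sum_le_esum u AD.
have : \sum_(t <- fset_set A0) u t <= \sum_(t <- A) u t.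
  rewrite [leRHS](big_fsetID _ (mem (fset_set A0)))/=.
  rewrite (_ : [fset x in A | x \in fset_set A0]%fset = fset_set A0).
    by rewrite lerDl; apply: sumr_ge0.
  by apply/fsetP => t; rewrite !inE/= andb_idl// => /(fsubsetP A0A).
move: fn; case: (\esum_(t in D) (u t)%:E)%E => // s _.
rewrite -EFinB !lee_fin lte_fin /= => h1 h2 h3.
by rewrite ger0_norm; lra.
Qed.

Lemma rsumE u : rsum D u = fine (\esum_(t in D) (Num.max (u t) 0)%:E)
                         - fine (\esum_(t in D) (Num.max (- u t) 0)%:E).
Proof.
rewrite /rsum; congr (fine _ - fine _); apply: eq_esum => t _.
  by rewrite funeposE /= EFin_max.
by rewrite funenegE /= EFin_max.
Qed.

Lemma rsummable_le u v : (forall t, D t -> `|u t| <= v t) ->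
  (\esum_(t in D) (v t)%:E < +oo)%E -> rsummable u.
Proof.
by move=> uv; apply: le_lt_trans; apply: le_esum => t /uv; rewrite lee_fin.
Qed.

(** For a summable family the difference of the sums of the positive and
    negative parts is the limit of the finite subsums; every property of sums
    used below is read off the finite subsums. *)
Lemma rsum_approx u (e : R) : rsummable u -> 0 < e ->
  exists2 A0, [set` A0] `<=` D &
    forall A, [set` A] `<=` D -> (A0 `<=` A)%fset ->
      `|rsum D u - \sum_(t <- A) u t| <= e.
Proof.
move=> su e0; have e20 : 0 < e / 2 by rewrite divr_gt0.
have sp (w : T -> R) : (forall t, `|w t| <= `|u t|) ->
    rsummable (fun t => Num.max (w t) 0).
  move=> h; apply: rsummable_le su => t _; apply: le_trans (h t).
  by rewrite /Num.max; case: ifP => _; rewrite ?normr0.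
have ge0 (w : T -> R) t : 0 <= Num.max (w t) 0 by rewrite le_max lexx orbT.
have [A1 A1D h1] := ge0_esum_approx (ge0 u) (sp u (fun _ => lexx _)) e20.
have sN t : `|- u t| <= `|u t| by rewrite normrN.
have [A2 A2D h2] := ge0_esum_approx (ge0 _) (sp (fun t => - u t) sN) e20.
exists (A1 `|` A2)%fset.
  by move=> t /=; rewrite in_fsetU => /orP[/A1D|/A2D].
move=> A AD; rewrite fsubUset => /andP[/(h1 _ AD) l1 /(h2 _ AD) l2].
rewrite rsumE (_ : \sum_(t <- A) u t = \sum_(t <- A) Num.max (u t) 0
    - \sum_(t <- A) Num.max (- u t) 0); last first.
  rewrite -sumrB; apply: eq_bigr => t _; rewrite /Num.max; do 2!case: ifP; lra.
move: l1 l2; set p := fine _; set q := fine _ => l1 l2.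
rewrite (_ : _ - _ = (p - \sum_(t <- A) Num.max (u t) 0)
  - (q - \sum_(t <- A) Num.max (- u t) 0)); last by ring.
by apply: le_trans (ler_normB _ _) _; lra.
Qed.

Lemma le_of_le_eps (x y : R) (k : R) : 0 <= k ->
  (forall e, 0 < e -> x <= y + k * e) -> x <= y.
Proof.
move=> k0 h; apply/ler_addgt0Pr => e e0.
have k1 : 0 < k + 1 by rewrite ltr_wpDl.
apply: le_trans (h (e / (k + 1)) (divr_gt0 e0 k1)) _.
rewrite lerD2l mulrCA ger_pMr// ler_pdivrMr//; lra.
Qed.

Lemma rsumD u v : rsummable u -> rsummable v ->
  rsum D (fun t => u t + v t) = rsum D u + rsum D v.
Proof.
move=> su sv; have suv : rsummable (fun t => u t + v t).
  apply: (@rsummable_le _ (fun t => `|u t| + `|v t|)).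
    by move=> t _; exact: ler_normD.
  rewrite /rsummable in su sv *.
  under eq_esum do rewrite EFinD.
  rewrite esumD//; [exact: lte_add_pinfty|by move=> ? _; rewrite lee_fin..].
apply/eqP; rewrite -subr_eq0 -normr_le0.
apply: (@le_of_le_eps _ 0 3) => // e e0; rewrite add0r.
have [A1 A1D h1] := rsum_approx su e0.
have [A2 A2D h2] := rsum_approx sv e0.
have [A3 A3D h3] := rsum_approx suv e0.
pose A := (A1 `|` (A2 `|` A3))%fset.
have AD : [set` A] `<=` D.
  by move=> t /=; rewrite !in_fsetU => /or3P[/A1D|/A2D|/A3D].
have {}h1 := h1 A AD (fsubsetUl _ _).
have {}h2 := h2 A AD (fsubset_trans (fsubsetUl _ _) (fsubsetUr _ _)).
have {}h3 := h3 A AD (fsubset_trans (fsubsetUr _ _) (fsubsetUr _ _)).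
move: h3; rewrite big_split/=.
move: h1 h2; rewrite !ler_norml.
by move=> /andP[? ?] /andP[? ?] /andP[? ?]; apply/andP; split; lra.
Qed.

Lemma rsum_ge0E u : (forall t, D t -> 0 <= u t) -> rsummable u ->
  (rsum D u)%:E = \esum_(t in D) (u t)%:E.
Proof.
move=> u0 su; rewrite rsumE [X in _ - fine X]esum1 ?subr0; last first.
  by move=> t Dt; rewrite max_r// oppr_le0 u0.
rewrite (_ : esum _ _ = \esum_(t in D) (u t)%:E)%E; last first.
  by apply: eq_esum => t Dt; rewrite max_l// u0.
rewrite fineK// ge0_fin_numE; last by apply: esum_ge0 => t /u0.
by apply: le_lt_trans su; apply: le_esum => t Dt; rewrite lee_fin ler_norm.
Qed.

End Summation.

(** * Square summable matrix-valued sequences on Lambda *)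

Section ComplexSummation.
Variables (R : realType) (T : choiceType) (D : set T).
Implicit Types u v : T -> R[i].

Definition csummable u := (\esum_(t in D) (cmod (u t))%:E < +oo)%E.

Lemma csummable_Re u : csummable u -> rsummable D (fun t => complex.Re (u t)).
Proof. by apply: rsummable_le => t _; exact: le_abs_Re. Qed.

Lemma csummable_Im u : csummable u -> rsummable D (fun t => complex.Im (u t)).
Proof. by apply: rsummable_le => t _; exact: le_abs_Im. Qed.

Lemma csum_approx u (e : R) : csummable u -> 0 < e ->
  exists2 A0 : {fset T}, [set` A0] `<=` D &
    forall A : {fset T}, [set` A] `<=` D -> (A0 `<=` A)%fset ->
      cmod (csum D u - \sum_(t <- A) u t) <= e.
Proof.
move=> su e0; have e20 : 0 < e / 2 by rewrite divr_gt0.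
have [A1 A1D h1] := rsum_approx (csummable_Re su) e20.
have [A2 A2D h2] := rsum_approx (csummable_Im su) e20.
exists (A1 `|` A2)%fset.
  by move=> t /=; rewrite in_fsetU => /orP[/A1D|/A2D].
move=> A AD; rewrite fsubUset => /andP[/(h1 _ AD) l1 /(h2 _ AD) l2].
apply: le_trans (le_cmod_Re_Im _) _.
rewrite ReD ImD; move: l1 l2; rewrite -Re_sum -Im_sum /=.
by case: (\sum_(t <- A) u t) => a b /=; lra.
Qed.

Lemma csumD u v : csummable u -> csummable v ->
  csum D (fun t => u t + v t) = csum D u + csum D v.
Proof.
move=> su sv; rewrite /csum.
have -> : (fun t => complex.Re (u t + v t)) =
    (fun t => complex.Re (u t) + complex.Re (v t)).
  by apply/funext => t; exact: ReD.
have -> : (fun t => complex.Im (u t + v t)) =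
    (fun t => complex.Im (u t) + complex.Im (v t)).
  by apply/funext => t; exact: ImD.
rewrite (rsumD (csummable_Re su) (csummable_Re sv)).
by rewrite (rsumD (csummable_Im su) (csummable_Im sv)).
Qed.

End ComplexSummation.

Section SquareSummableMatrices.
Variables (R : realType) (n N r : nat).
Hypothesis N_gt0 : (0 < N)%N.
Implicit Types (f g h : R -> 'M[R[i]]_n) (l : R) (A : {fset R}).

(** Lambda is a union of cosets of 2Z, and 2 N l' is an even integer because
    the denominator of l' divides N. *)
Lemma Lambda_addN l l' : Lambda N r l -> Lambda N r l' ->
  Lambda N r (l + 2 * N%:R * l').
Proof.
have N0 : N%:R != 0 :> R by rewrite pnatr_eq0 -lt0n.
case=> c hc [z _ <-] [c' hc' [z' _ <-]]; exists c => //.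
case: hc' => ->.
  exists (z + N%:Z * z' + N%:Z * z') => //.
  by rewrite !intrD !intrM -!pmulrn; ring.
exists (z + r%:Z + N%:Z * z' + N%:Z * z') => //.
by rewrite !intrD !intrM -!pmulrn; field.
Qed.

Lemma Lambda_subN l l' : Lambda N r l -> Lambda N r l' ->
  Lambda N r (l - 2 * N%:R * l').
Proof.
have N0 : N%:R != 0 :> R by rewrite pnatr_eq0 -lt0n.
case=> c hc [z _ <-] [c' hc' [z' _ <-]]; exists c => //.
case: hc' => ->.
  exists (z - N%:Z * z' - N%:Z * z') => //.
  by rewrite !intrB !intrM -!pmulrn; ring.
exists (z - r%:Z - N%:Z * z' - N%:Z * z') => //.
by rewrite !intrB !intrM -!pmulrn; field.
Qed.

Definition square_summable f :=
  (\esum_(l in Lambda N r) (frobsq (f l))%:E < +oo)%E.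

Lemma ell2_square_summable f : ell2 N r f -> square_summable f.
Proof. by case. Qed.

Lemma square_summableD f g : square_summable f -> square_summable g ->
  square_summable (fun l => f l + g l).
Proof.
rewrite /square_summable => sf sg.
apply: (@le_lt_trans _ _ (\esum_(l in Lambda N r)
   ((frobsq (f l))%:E + (frobsq (f l))%:E +
    ((frobsq (g l))%:E + (frobsq (g l))%:E)))%E).
  apply: le_esum => l _; rewrite -!EFinD lee_fin.
  by have := frobsqD_le (f l) (g l); lra.
by rewrite !esumD ?lte_add_pinfty//;
   move=> *; rewrite -?EFinD lee_fin ?addr_ge0 ?frobsq_ge0.
Qed.

Lemma square_summable_displacement f l : Lambda N r l -> square_summable f ->
  square_summable (displacement N l f).
Proof.
move=> Ll; apply: le_lt_trans; apply: esum_le_fset => A AL.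
rewrite /displacement.
have inj : {in A &, injective (fun t : R => t - 2 * N%:R * l)}.
  by move=> x y _ _ /addIr.
rewrite -(big_imfset _ imfset_key (fun t => frobsq (f t)) inj)/=.
apply: fset_sum_le_esum => _ /= /imfsetP[t /= tA ->].
by apply: Lambda_subN => //; apply: AL.
Qed.

Lemma csummable_frobdot f g : square_summable f -> square_summable g ->
  csummable (Lambda N r) (fun l => frobdot (f l) (g l)).
Proof.
rewrite /square_summable => sf sg.
apply: (@le_lt_trans _ _ (\esum_(l in Lambda N r)
   ((frobsq (f l))%:E + (frobsq (g l))%:E))%E).
  by apply: le_esum => l _; rewrite -EFinD lee_fin cmod_frobdot_le.
by rewrite esumD ?lte_add_pinfty//; move=> *; rewrite lee_fin frobsq_ge0.
Qed.

Lemma ell2_innerDr h f g :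
  square_summable h -> square_summable f -> square_summable g ->
  ell2_inner N r h (fun l => f l + g l) =
  ell2_inner N r h f + ell2_inner N r h g.
Proof.
move=> sh sf sg; rewrite -csumD ?(csummable_frobdot sh)//.
by congr csum; apply/funext => l; rewrite -[LHS]/(frobdot _ _) frobdotDr.
Qed.

Lemma ell2_norm_sq h : square_summable h ->
  (ell2_norm N r h ^+ 2)%:E = \esum_(l in Lambda N r) (frobsq (h l))%:E.
Proof.
move=> sh; rewrite /ell2_norm; have -> : complex.Re (ell2_inner N r h h) =
    rsum (Lambda N r) (fun l => frobsq (h l)).
  by rewrite /=; congr rsum; apply/funext => l; exact: Re_frobdot_self.
have sn : rsummable (Lambda N r) (fun l => frobsq (h l)).
  by apply: rsummable_le sh => l _; rewrite ger0_norm// frobsq_ge0.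
have e := rsum_ge0E (fun l _ => frobsq_ge0 (h l)) sn.
rewrite sqr_sqrtr// -lee_fin e; apply: esum_ge0 => l _.
by rewrite lee_fin frobsq_ge0.
Qed.

Lemma fset_sum_le_norm h A : square_summable h -> [set` A] `<=` Lambda N r ->
  \sum_(l <- A) frobsq (h l) <= ell2_norm N r h ^+ 2.
Proof.
by move=> sh AL; rewrite -lee_fin ell2_norm_sq//; exact: fset_sum_le_esum.
Qed.

End SquareSummableMatrices.

(** * Orthogonality of the exponentials on Omega *)

Section Orthonormality.
Variable R : realType.
Variables N r : nat.
Hypothesis N_gt0 : (0 < N)%N.
Notation mu := (@lebesgue_measure R).
Notation Omega := (@Omega R N).

Lemma measurable_Omega : measurable Omega.
Proof. by apply: measurableU; exact: measurable_itv. Qed.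

Lemma continuous_integrable_Omega (f : R -> R) :
  continuous f -> mu.-integrable Omega (EFin \o f).
Proof.
move=> cf; have N0 : 1 <= N%:R :> R by rewrite ler1n.
have sub (x : R) : Omega x -> x \in `[0, (N%:R + 1) / 2].
  by case; rewrite /= !in_itv/= => /andP[h1 h2]; apply/andP; split; lra.
apply: (@integrableS _ _ _ mu (`[0, (N%:R + 1) / 2])).
- exact: measurable_itv.
- exact: measurable_Omega.
- exact: sub.
- apply: continuous_compact_integrable; first exact: segment_compact.
  exact: continuous_subspaceT.
Qed.

Lemma integral_itv_FTC (f F : R -> R) (a b : R) : a < b -> continuous f ->
  (forall x : R, is_derive x 1 F (f x)) ->
  (\int[mu]_(x in `[a, b[) (f x)%:E = (F b - F a)%:E)%E.
Proof.
move=> ab cf dF; rewrite integral_itv_bndo_bndc; last first.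
  apply/measurable_EFinP; apply: measurable_funTS.
  exact: continuous_measurable_fun.
have cF : continuous F.
  move=> x; apply: differentiable_continuous; apply/derivable1_diffP.
  by have [] := dF x.
rewrite (@continuous_FTC2 _ _ F)//.
- exact: continuous_subspaceT.
- split; [by move=> x _; have [] := dF x| |].
  + exact: cvg_at_right_filter (cF a).
  + exact: cvg_at_left_filter (cF b).
- by move=> x _; rewrite derive1E; have [] := dF x.
Qed.

Lemma integral_Omega_FTC (f F : R -> R) : continuous f ->
  (forall x : R, is_derive x 1 F (f x)) ->
  (\int[mu]_(x in Omega) (f x)%:E =
    (F (1 / 2) - F 0 + (F ((N%:R + 1) / 2) - F (N%:R / 2)))%:E)%E.
Proof.
move=> cf dF; have N0 : 1 <= N%:R :> R by rewrite ler1n.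
have disj (x : R) : x \in `[0, 1 / 2[ -> x \in `[N%:R / 2, (N%:R + 1) / 2[ ->
    False.
  by rewrite !in_itv/= => /andP[_ h] /andP[h' _]; lra.
rewrite integral_setU.
- by rewrite !(integral_itv_FTC _ cf dF) ?EFinD//; lra.
- exact: measurable_itv.
- exact: measurable_itv.
- apply/measurable_EFinP; apply: measurable_funTS.
  exact: continuous_measurable_fun.
- by apply/disj_setPS => x [] /= h /(disj x h).
Qed.

Lemma cexp2pi_nat k : cexp2pi k%:R = 1 :> R[i].
Proof.
elim: k => [|k ih]; first by rewrite /cexp2pi mulr0 cos0 sin0.
rewrite -natr1 cexp2piD ih mul1r /cexp2pi mulr1 mulr_natl.
by rewrite cos2pi sin2pi.
Qed.

Lemma cexp2pi_int (z : int) : cexp2pi z%:~R = 1 :> R[i].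
Proof.
case: z => k; first exact: cexp2pi_nat.
by rewrite NegzE rmorphN/= -cexp2pi_conj cexp2pi_nat/= oppr0.
Qed.

Lemma cexp2pi_half_odd k : odd k -> cexp2pi (k%:R / 2) = -1 :> R[i].
Proof.
move=> ko; rewrite -(odd_double_half k) ko natrD mulrDl -muln2 natrM mulfK//.
rewrite cexp2piD cexp2pi_nat mulr1 /cexp2pi.
rewrite (_ : 2 * pi * (1 / 2) = pi); last by field.
by rewrite cospi sinpi; congr Complex; rewrite oppr0.
Qed.

(** Omega is a half unit interval together with its translate by N / 2. For
    an even integer frequency both pieces integrate to 0 over whole periods;
    for a frequency in +-r/N + 2Z the translate contributes the opposite of
    the first piece since r is odd. *)
Lemma Lambda_sub_cancel l l' : odd r -> Lambda N r l -> Lambda N r l' ->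
  (cexp2pi ((l - l') * (1 / 2)) - 1) *
    (1 + cexp2pi ((l - l') * (N%:R / 2))) = 0 :> R[i].
Proof.
have N0 : N%:R != 0 :> R by rewrite pnatr_eq0 -lt0n.
move=> ro [c hc [z _ <-]] [c' hc' [z' _ <-]].
have same : cexp2pi ((c + 2 * z%:~R - (c + 2 * z'%:~R)) * (1 / 2)) = 1 :> R[i].
  rewrite -[RHS](cexp2pi_int (z - z')) rmorphB/=; congr cexp2pi.
  by field.
case: hc hc' same => -> [] -> same; rewrite ?same ?subrr ?mul0r//;
  apply/eqP; rewrite mulf_eq0; apply/orP; right.
- rewrite (_ : _ * (N%:R / 2) = N%:R * (z - z')%:~R - r%:R / 2); last first.
    by rewrite rmorphB/=; field.
  rewrite -[N%:R]/(N%:Z%:~R) -rmorphM/= cexp2piD cexp2pi_int mul1r.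
  by rewrite -cexp2pi_conj cexp2pi_half_odd// rmorphN rmorph1 subrr.
- rewrite (_ : _ * (N%:R / 2) = N%:R * (z - z')%:~R + r%:R / 2); last first.
    by rewrite rmorphB/=; field.
  rewrite -[N%:R]/(N%:Z%:~R) -rmorphM/= cexp2piD cexp2pi_int mul1r.
  by rewrite cexp2pi_half_odd// subrr.
Qed.

Lemma continuous_cosM (c : R) : continuous (fun x => cos (c * x)).
Proof.
move=> x; apply: continuous_comp; first exact: mulrl_continuous.
exact: continuous_cos.
Qed.

Lemma continuous_sinM (c : R) : continuous (fun x => sin (c * x)).
Proof.
move=> x; apply: continuous_comp; first exact: mulrl_continuous.
exact: continuous_sin.
Qed.

Lemma is_derive_scale (f df : R -> R) (c x : R) :
  (forall y : R, is_derive y 1 f (df y)) ->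
  is_derive x 1 (fun y : R => f (c * y)) (c * df (c * x)).
Proof.
move=> dfy; have dg : is_derive x (1 : R) (fun y : R => c * y) c.
  by rewrite -[X in is_derive _ _ _ X](mulr1 c); exact: is_deriveZ.
by rewrite mulrC; exact: (is_derive1_comp (dfy (c * x)) dg).
Qed.

(** Integrating an exponential over the two intervals of Omega by its
    antiderivative leaves, up to a constant, the product of
    [Lambda_sub_cancel]. *)
Lemma integral_Omega_cexp2pi (l l' : R) : odd r -> Lambda N r l ->
  Lambda N r l' -> l != l' ->
  (\int[mu]_(x in Omega) (complex.Re (cexp2pi ((l - l') * x)))%:E = 0 /\
   \int[mu]_(x in Omega) (complex.Im (cexp2pi ((l - l') * x)))%:E = 0)%E.
Proof.
move=> ro Ll Ll' ll'; set c := 2 * pi * (l - l').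
have c0 : c != 0.
  by rewrite !mulf_neq0 ?subr_eq0 ?pnatr_eq0// gt_eqF// pi_gt0.
have eE x : cexp2pi ((l - l') * x) = Complex (cos (c * x)) (sin (c * x)).
  by rewrite /cexp2pi mulrA.
have := Lambda_sub_cancel ro Ll Ll'.
have pE (a b : R[i]) : (a - 1) * (1 + b) = a - 1 + (a * b - b) by ring.
rewrite {}pE -cexp2piD.
rewrite -mulrDr (_ : 1 / 2 + N%:R / 2 = (N%:R + 1) / 2); last by field.
rewrite !eE => -[hc hs].
have dsin (x : R) :
    is_derive x (1 : R) (fun x => c^-1 * sin (c * x)) (cos (c * x)).
  rewrite -[X in is_derive _ _ _ X](mulKf c0).
  by apply: is_deriveZ; exact: is_derive_scale.
have dcos (x : R) :
    is_derive x (1 : R) (fun x => - c^-1 * cos (c * x)) (sin (c * x)).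
  rewrite -[X in is_derive _ _ _ X](mulKf c0) -mulrNN -mulrN.
  by apply: is_deriveZ; exact: is_derive_scale.
split.
- under eq_integral do rewrite eE /=.
  rewrite (integral_Omega_FTC (@continuous_cosM c) dsin); congr EFin.
  rewrite -!mulrBr -mulrDr mulr0 sin0.
  by rewrite hs mulr0.
- under eq_integral do rewrite eE /=.
  rewrite (integral_Omega_FTC (@continuous_sinM c) dcos); congr EFin.
  rewrite -!mulrBr -mulrDr mulr0 cos0.
  by rewrite hc mulr0.
Qed.

Lemma integral_Omega_cexp2pi0 :
  (\int[mu]_(x in Omega) (complex.Re (cexp2pi (0 * x)))%:E = 1 /\
   \int[mu]_(x in Omega) (complex.Im (cexp2pi (0 * x)))%:E = 0)%E.
Proof.
have e0 (x : R) : cexp2pi (0 * x) = 1 by rewrite mul0r -[0]/(0%:R) cexp2pi_nat.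
split; under eq_integral do rewrite e0 /=; last by rewrite integral0.
have c1 : continuous (fun _ : R => 1 : R) by exact: cst_continuous.
rewrite (integral_Omega_FTC c1 (fun x => is_derive_id x 1)).
by rewrite (_ : _ - _ + _ = 1)//=; field.
Qed.

End Orthonormality.

(** * Trigonometric polynomials with frequencies in Lambda *)

Section Parseval.
Variable R : realType.
Variables N r : nat.
Hypothesis N_gt0 : (0 < N)%N.
Hypothesis r_odd : odd r.
Notation mu := (@lebesgue_measure R).
Notation Omega := (@Omega R N).
Implicit Types (A B S : {fset R}) (q c phi : R -> R[i]).

Definition trigpoly q A (x : R) : R[i] := \sum_(l <- A) q l * cexp2pi (l * x).

Lemma continuous_Re_cexp2pi (w : R[i]) (a : R) :
  continuous (fun x : R => complex.Re (w * cexp2pi (a * x))).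
Proof.
have -> : (fun x : R => complex.Re (w * cexp2pi (a * x))) =
    (fun x => complex.Re w * cos (2 * pi * a * x)
            - complex.Im w * sin (2 * pi * a * x)).
  by apply/funext => x; case: w => u v; rewrite /= mulrA.
move=> x; apply: cvgB; apply: cvgM; try exact: cvg_cst.
- exact: continuous_cosM.
- exact: continuous_sinM.
Qed.

Lemma ReM_cexp2pi (w : R[i]) (t : R) : complex.Re (w * cexp2pi t) =
  complex.Re w * complex.Re (cexp2pi t) +
  (- complex.Im w) * complex.Im (cexp2pi t).
Proof. by case: w => u v /=; rewrite mulNr. Qed.

Lemma integral_Omega_Re_cexp2pi (w : R[i]) (l l' : R) : Lambda N r l ->
  Lambda N r l' ->
  (\int[mu]_(x in Omega) (complex.Re (w * cexp2pi ((l - l') * x)))%:E =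
   (if l == l' then complex.Re w else 0)%:E)%E.
Proof.
move=> Ll Ll'; under eq_integral do rewrite ReM_cexp2pi EFinD !EFinM.
have iR : mu.-integrable Omega
    (fun x => (complex.Re (cexp2pi ((l - l') * x)))%:E).
  apply: (continuous_integrable_Omega N_gt0).
  by have := @continuous_Re_cexp2pi 1 (l - l'); under eq_fun do rewrite mul1r.
have iI : mu.-integrable Omega
    (fun x => (complex.Im (cexp2pi ((l - l') * x)))%:E).
  apply: (continuous_integrable_Omega N_gt0).
  rewrite [X in continuous X]
    (_ : _ = (fun x : R => sin (2 * pi * (l - l') * x))).
    exact: continuous_sinM.
  by apply/funext => x; rewrite /cexp2pi/= mulrA.
have mO := @measurable_Omega R N.
rewrite integralD//; [|exact: integrableZl..].
rewrite !integralZl//; case: eqP => [<-|/eqP ll'].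
  have [] := @integral_Omega_cexp2pi0 R N N_gt0; rewrite subrr => -> ->.
  by rewrite mule1 mule0 adde0.
have [-> ->] := integral_Omega_cexp2pi N_gt0 r_odd Ll Ll' ll'.
by rewrite !mule0 adde0.
Qed.

(** Expanding the square, the cross terms integrate to 0 because two distinct
    exponentials are orthogonal, and each diagonal term is integrated over a set
    of measure 1. *)
Lemma parseval q A : [set` A] `<=` Lambda N r ->
  (\int[mu]_(x in Omega) (cmod (trigpoly q A x) ^+ 2)%:E =
   (\sum_(l <- A) cmod (q l) ^+ 2)%:E)%E.
Proof.
move=> AL; have mO := @measurable_Omega R N.
have eE x : cmod (trigpoly q A x) ^+ 2 = \sum_(l <- A) \sum_(l' <- A)
    complex.Re ((q l * conjc (q l')) * cexp2pi ((l - l') * x)).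
  rewrite -[LHS]/(complex.Re (Complex _ 0)) -mul_conjc.
  rewrite /trigpoly mulr_suml Re_sum.
  apply: eq_bigr => l _; rewrite rmorph_sum mulr_sumr Re_sum.
  apply: eq_bigr => l' _; rewrite mulrBl cexp2piD -cexp2pi_conj rmorphM/=.
  by congr complex.Re; ring.
under eq_integral do rewrite eE -sumEFin.
rewrite integral_sum//; last first.
  move=> l; under eq_fun do rewrite -sumEFin.
  apply: integrable_sum => // l' _.
  exact/(continuous_integrable_Omega N_gt0)/continuous_Re_cexp2pi.
rewrite -sumEFin big_seq [RHS]big_seq; apply: eq_bigr => l lA.
under eq_integral do rewrite -sumEFin.
rewrite integral_sum//; last first.
  move=> l'.
  exact/(continuous_integrable_Omega N_gt0)/continuous_Re_cexp2pi.
rewrite big_seq.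
under eq_bigr => l' l'A.
  rewrite integral_Omega_Re_cexp2pi; [|exact: AL..]; over.
rewrite sumEFin -big_seq (big_fsetD1 l)//= eqxx mul_conjc.
rewrite big_seq big1 ?addr0// => l'; rewrite !inE => /andP[+ _].
by rewrite eq_sym => /negbTE ->.
Qed.

(** Multiplying a trigonometric polynomial by another one whose frequencies lie
    in 2 N Lambda convolves the coefficients; the frequencies stay in Lambda, so
    that Parseval's identity bounds any part of the coefficients. *)
Lemma convolution_bessel c phi A B S : [set` A] `<=` Lambda N r ->
  [set` B] `<=` Lambda N r -> [set` S] `<=` Lambda N r ->
  ((\sum_(l <- B) cmod (\sum_(s <- S) c s *
      (if l - 2 * N%:R * s \in A then phi (l - 2 * N%:R * s) else 0)) ^+ 2)%:E
   <= \int[mu]_(x in Omega) (cmod ((\sum_(s <- S) c s *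
        cexp2pi (2 * N%:R * s * x)) * trigpoly phi A x) ^+ 2)%:E)%E.
Proof.
move=> AL BL SL; pose psi l := \sum_(s <- S) c s *
  (if l - 2 * N%:R * s \in A then phi (l - 2 * N%:R * s) else 0).
pose B' := (B `|` [fset (l + 2 * N%:R * s)%R | l in A, s in S])%fset.
have B'L : [set` B'] `<=` Lambda N r.
  move=> l /=; rewrite in_fsetU => /orP[/BL//|].
  case/imfset2P => /= a aA [s sS ->].
  by apply: Lambda_addN; [|exact: AL|exact: SL].
have eQ x : (\sum_(s <- S) c s * cexp2pi (2 * N%:R * s * x)) *
    trigpoly phi A x = trigpoly psi B' x.
  rewrite mulr_suml /trigpoly.
  under [RHS]eq_bigr do rewrite mulr_suml.
  rewrite exchange_big/= big_seq [RHS]big_seq; apply: eq_bigr => s sS.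
  under [RHS]eq_bigr do rewrite -mulrA (fun_if (fun u => u * _)) mul0r.
  rewrite -mulr_sumr -big_mkcond -mulrA; congr (_ * _).
  rewrite [in RHS]big_fset_condE.
  have inj : {in A &, injective (fun l : R => l + 2 * N%:R * s)}.
    by move=> u v _ _ /addIr.
  have -> : [fset l in B' | (l - 2 * N%:R * s)%R \in A]%fset =
      [fset (l + 2 * N%:R * s)%R | l in A]%fset.
    apply/fsetP => l; rewrite !inE/=; apply/andP/imfsetP => /=.
      by case=> _ lA; exists (l - 2 * N%:R * s) => //; rewrite subrK.
    case=> a aA ->; rewrite addrK; split=> //; apply/orP; right.
    by apply/imfset2P; exists a => //; exists s.
  rewrite big_imfset//= mulr_sumr; apply: eq_bigr => l _.
  by rewrite addrK (mulrDl l) cexp2piD; ring.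
under eq_integral do rewrite eQ.
rewrite parseval// lee_fin [leRHS](big_fsetID _ (mem B))/=.
rewrite (_ : [fset x in B' | x \in B]%fset = B).
  by rewrite lerDl; apply: sumr_ge0 => *; exact: sqr_ge0.
by apply/fsetP => l; rewrite !inE/= andb_idl// => ->.
Qed.

End Parseval.

(** * Products of trigonometric polynomials with measurable functions *)

Section FourierMultiplier.
Variables (R : realType) (N : nat).
Notation mu := (@lebesgue_measure R).
Notation Omega := (@Omega R N).
Implicit Types (A B S : {fset R}) (q c : R -> R[i]).

Definition cmeasurable (u : R -> R[i]) :=
  measurable_fun Omega (fun x : R => complex.Re (u x)) /\
  measurable_fun Omega (fun x : R => complex.Im (u x)).

Lemma measurable_cmod_sq u : cmeasurable u ->
  measurable_fun Omega (fun x : R => cmod (u x) ^+ 2).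
Proof.
case=> mR mI; under eq_fun do rewrite cmod_sq.
by apply: measurable_funD; exact: measurable_funX.
Qed.

Lemma cmeasurableB u v : cmeasurable u -> cmeasurable v ->
  cmeasurable (fun x => u x - v x).
Proof.
move=> [uR uI] [vR vI]; split.
  rewrite (_ : (fun x => _) =
      (fun x => complex.Re (u x)) \- (fun x => complex.Re (v x))).
    exact: measurable_funB.
  by apply/funext => x /=; case: (u x) (v x) => a b [a' b'].
rewrite (_ : (fun x => _) =
    (fun x => complex.Im (u x)) \- (fun x => complex.Im (v x))).
  exact: measurable_funB.
by apply/funext => x /=; case: (u x) (v x) => a b [a' b'].
Qed.

Lemma cmeasurable_trigpoly q A : cmeasurable (trigpoly q A).
Proof.
have mRe (w : R[i]) (l : R) :
    measurable_fun Omega (fun x : R => complex.Re (w * cexp2pi (l * x))).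
  apply: measurable_funTS; apply: continuous_measurable_fun.
  exact: continuous_Re_cexp2pi.
split; rewrite /trigpoly.
  under eq_fun do rewrite Re_sum.
  by apply: measurable_sum => l; exact: mRe.
under eq_fun do rewrite Im_sum.
apply: measurable_sum => l.
(* Im z = Re (- i z) *)
have -> : (fun x : R => complex.Im (q l * cexp2pi (l * x))) =
    (fun x : R => complex.Re ((q l * Complex 0 (-1)) * cexp2pi (l * x))).
  by apply/funext => x; case: (q l) => a b /=; ring.
exact: mRe.
Qed.

(** The approximation error is multiplied by a bounded function only, so it
    stays small; the price is the factor 1 + t on the main term, with t at
    our disposal. *)
Lemma multiplier_approx q c A S (u : R -> R[i]) (M d t : R) :
  cmeasurable u -> 0 < t ->
  (forall x, cmod (trigpoly c S x) <= M) ->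
  (\int[mu]_(x in Omega) (cmod (trigpoly q A x - u x) ^+ 2)%:E <= d%:E)%E ->
  (\int[mu]_(x in Omega) (cmod (trigpoly c S x * trigpoly q A x) ^+ 2)%:E <=
   (1 + t)%:E * \int[mu]_(x in Omega)
      (cmod (trigpoly c S x) ^+ 2 * cmod (u x) ^+ 2)%:E
   + ((1 + t^-1) * M ^+ 2 * d)%:E)%E.
Proof.
move=> mu_ t0 hM hd; have mO := @measurable_Omega R N.
have mP := measurable_cmod_sq (cmeasurable_trigpoly c S).
have mQ := measurable_cmod_sq (cmeasurable_trigpoly q A).
have mU := measurable_cmod_sq mu_.
have mD := measurable_cmod_sq (cmeasurableB (cmeasurable_trigpoly q A) mu_).
have t1 : 0 <= 1 + t by rewrite addr_ge0// ltW.
have t2 : 0 <= (1 + t^-1) * M ^+ 2.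
  by rewrite mulr_ge0 ?sqr_ge0// addr_ge0// invr_ge0 ltW.
have mPU : measurable_fun Omega
    (fun x : R => (cmod (trigpoly c S x) ^+ 2 * cmod (u x) ^+ 2)%:E).
  by apply/measurable_EFinP; exact: measurable_funM.
have mDE : measurable_fun Omega
    (fun x : R => (cmod (trigpoly q A x - u x) ^+ 2)%:E).
  exact/measurable_EFinP.
have PU0 (x : R) : Omega x ->
    (0 <= (cmod (trigpoly c S x) ^+ 2 * cmod (u x) ^+ 2)%:E)%E.
  by move=> _; rewrite lee_fin mulr_ge0// sqr_ge0.
have D0 (x : R) : Omega x -> (0 <= (cmod (trigpoly q A x - u x) ^+ 2)%:E)%E.
  by move=> _; rewrite lee_fin sqr_ge0.
apply: (@le_trans _ _ (\int[mu]_(x in Omega)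
  ((1 + t)%:E * (cmod (trigpoly c S x) ^+ 2 * cmod (u x) ^+ 2)%:E +
   ((1 + t^-1) * M ^+ 2)%:E * (cmod (trigpoly q A x - u x) ^+ 2)%:E))%E).
  apply: ge0_le_integral => //.
  - by move=> x _; rewrite lee_fin sqr_ge0.
  - under eq_fun do rewrite cmodM exprMn.
    by apply/measurable_EFinP; exact: measurable_funM.
  - apply: emeasurable_funD; apply: measurable_funeM => //.
  - move=> x _; rewrite -!EFinM -EFinD lee_fin.
    have -> : trigpoly c S x * trigpoly q A x =
        trigpoly c S x * u x + trigpoly c S x * (trigpoly q A x - u x) by ring.
    apply: le_trans (cmodD_sq_le _ _ t0) _; rewrite !cmodM !exprMn lerD2l.
    have hP := cmod_ge0 (trigpoly c S x).
    have t3 : 0 <= 1 + t^-1 by rewrite addr_ge0// invr_ge0 ltW.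
    rewrite mulrA; apply: ler_pM; rewrite ?sqr_ge0 ?mulr_ge0 ?sqr_ge0//.
    apply: ler_pM; rewrite ?sqr_ge0//.
    by rewrite lerXn2r ?nnegrE// (le_trans hP (hM x)).
have PU0' (x : R) : Omega x -> (0 <= (1 + t)%:E *
    (cmod (trigpoly c S x) ^+ 2 * cmod (u x) ^+ 2)%:E)%E.
  by move=> Ox; rewrite mule_ge0 ?lee_fin// -lee_fin PU0.
have D0' (x : R) : Omega x -> (0 <= ((1 + t^-1) * M ^+ 2)%:E *
    (cmod (trigpoly q A x - u x) ^+ 2)%:E)%E.
  by move=> Ox; rewrite mule_ge0 ?lee_fin// -lee_fin D0.
have mPU' := measurable_funeM (1 + t)%:E mPU.
have mDE' := measurable_funeM ((1 + t^-1) * M ^+ 2)%:E mDE.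
rewrite ge0_integralD//.
rewrite !ge0_integralZl_EFin// leeD2l// [leRHS]EFinM.
exact: lee_wpmul2l.
Qed.

End FourierMultiplier.

(** * Displacements of a sequence with bounded Fourier transform *)

Section BoundedFourierTransform.
Variable R : realType.
Variables n N r : nat.
Hypothesis N_gt0 : (0 < N)%N.
Hypothesis r_odd : odd r.
Notation mu := (@lebesgue_measure R).
Notation Omega := (@Omega R N).
Variables (phi Phi : R -> 'M[R[i]]_n) (eps : R).
Hypothesis phi_fourier : is_fourier N r phi Phi.
Hypothesis Phi_bound :
  {ae (@lebesgue_measure R), forall x, Omega x -> mxnorm (Phi x) <= eps}.
Hypothesis eps_gt0 : 0 < eps.
Implicit Types (A B S : {fset R}) (c : R -> R[i]).

Lemma cmeasurable_fourier (m k : 'I_n) : cmeasurable N (fun x => Phi x m k).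
Proof. by have [/(_ m k)[]] := phi_fourier. Qed.

(** The L^2 limit is along the directed set of finite subsets of Lambda, so one
    finite A serves all entries at once and can moreover be chosen to contain
    any prescribed finite B. *)
Lemma fourier_approx (d : R) B : 0 < d -> [set` B] `<=` Lambda N r ->
  exists A, [/\ [set` A] `<=` Lambda N r, (B `<=` A)%fset &
    forall m k : 'I_n, (\int[mu]_(x in Omega)
      (cmod (trigpoly (fun l => phi l m k) A x - Phi x m k) ^+ 2)%:E
        <= d%:E)%E].
Proof.
move=> d0 BL; have [_ app] := phi_fourier.
have /choice[F hF] : forall i : 'I_n * 'I_n,
    exists A, [set` A] `<=` Lambda N r /\
    forall A', [set` A'] `<=` Lambda N r -> (A `<=` A')%fset ->
    (\int[mu]_(x in Omega) (cmod (trigpoly (fun l => phi l i.1 i.2) A' x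
        - Phi x i.1 i.2) ^+ 2)%:E <= d%:E)%E.
  move=> [m k]; have [A0 [finA0 A0L] hA0] := app m k d d0.
  exists (fset_set A0); split; first by rewrite fset_setK.
  move=> A' A'L sA; apply: ltW.
  have := hA0 [set` A'] (conj (finite_fset A') A'L).
  under eq_integral do rewrite fsbig_fset.
  by apply=> l /= A0l; apply: (fsubsetP sA); rewrite in_fset_set// inE.
pose A := (B `|` \bigcup_(i <- enum {: 'I_n * 'I_n}) F i)%fset.
have AL : [set` A] `<=` Lambda N r.
  move=> l /=; rewrite in_fsetU => /orP[/BL//|/bigfcupP[i _]].
  by have [h _] := hF i; exact: h.
exists A; split=> //; first exact: fsubsetUl.
move=> m k; have [_ h] := hF (m, k); apply: h => //.
by apply: fsubset_trans (fsubsetUr _ _); apply: bigfcup_sup; rewrite ?mem_enum.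
Qed.

Definition scaled S : {fset R} := [fset 2 * N%:R * s | s in S]%fset.

Lemma scaled_trigpoly c S x :
  \sum_(s <- S) c s * cexp2pi (2 * N%:R * s * x) =
  trigpoly (fun l => c (l / (2 * N%:R))) (scaled S) x.
Proof.
have N0 : 2 * N%:R != 0 :> R by rewrite mulf_neq0 ?pnatr_eq0// -lt0n.
rewrite /trigpoly /scaled big_imfset/=; last by move=> u v _ _ /(mulfI N0).
by apply: eq_bigr => s _; rewrite [_ * s]mulrC mulfK.
Qed.

Lemma scaled_Lambda S : [set` S] `<=` Lambda N r ->
  [set` scaled S] `<=` Lambda N r.
Proof.
move=> SL l /= /imfsetP[/= s sS ->]; rewrite -[_ * s]add0r.
apply: Lambda_addN => //; last exact: SL.
by exists 0; [left|exists 0 => //; rewrite mulr0 addr0].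
Qed.

Lemma frobsq_Phi_le : {ae (@lebesgue_measure R),
  forall x, Omega x -> frobsq (Phi x) <= eps ^+ 2}.
Proof.
have [Z [mZ Z0 hZ]] := Phi_bound.
exists Z; split=> // x /= h; apply: hZ => /= h'.
apply: h => /h'; rewrite /mxnorm -/(frobsq _) => le.
by rewrite -(sqr_sqrtr (frobsq_ge0 _)) lerXn2r ?nnegrE ?sqrtr_ge0// ltW.
Qed.

Lemma integral_multiplier_le q S : [set` S] `<=` Lambda N r ->
  (\sum_(m < n) \sum_(k < n) \int[mu]_(x in Omega)
    (cmod (trigpoly q S x) ^+ 2 * cmod (Phi x m k) ^+ 2)%:E <=
  (eps ^+ 2 * \sum_(l <- S) cmod (q l) ^+ 2)%:E)%E.
Proof.
move=> SL; have mO := @measurable_Omega R N.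
have mP := measurable_cmod_sq (cmeasurable_trigpoly N q S).
have mU m k : measurable_fun Omega (fun x : R =>
    (cmod (trigpoly q S x) ^+ 2 * cmod (Phi x m k) ^+ 2)%:E).
  apply/measurable_EFinP; apply: measurable_funM => //.
  exact: measurable_cmod_sq (cmeasurable_fourier m k).
have U0 m k (x : R) : Omega x ->
    (0 <= (cmod (trigpoly q S x) ^+ 2 * cmod (Phi x m k) ^+ 2)%:E)%E.
  by move=> _; rewrite lee_fin mulr_ge0// sqr_ge0.
rewrite (eq_bigr (fun m => \int[mu]_(x in Omega) \sum_(k < n)
    (cmod (trigpoly q S x) ^+ 2 * cmod (Phi x m k) ^+ 2)%:E)%E); last first.
  by move=> m _; rewrite ge0_integral_sum// => k; [exact: mU|exact: U0].
have mU2 m : measurable_fun Omega (fun x : R => (\sum_(k < n)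
    (cmod (trigpoly q S x) ^+ 2 * cmod (Phi x m k) ^+ 2)%:E)%E).
  by apply: emeasurable_sum => k.
have U02 m (x : R) : Omega x -> (0 <= \sum_(k < n)
    (cmod (trigpoly q S x) ^+ 2 * cmod (Phi x m k) ^+ 2)%:E)%E.
  by move=> Ox; apply: sume_ge0 => k _; exact: U0.
rewrite [leLHS](_ : _ = \int[mu]_(x in Omega) \sum_(m < n) \sum_(k < n)
    (cmod (trigpoly q S x) ^+ 2 * cmod (Phi x m k) ^+ 2)%:E)%E; last first.
  by rewrite ge0_integral_sum.
have mPE : measurable_fun Omega (fun x : R => (cmod (trigpoly q S x) ^+ 2)%:E).
  exact/measurable_EFinP.
have P0 (x : R) : Omega x -> (0 <= (cmod (trigpoly q S x) ^+ 2)%:E)%E.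
  by move=> _; rewrite lee_fin sqr_ge0.
have e20 : 0 <= eps ^+ 2 by exact: sqr_ge0.
rewrite EFinM -(parseval N_gt0 r_odd q SL) -ge0_integralZl_EFin//.
apply: ae_ge0_le_integral => //.
- by move=> x Ox; apply: sume_ge0 => m _; exact: U02.
- by apply: emeasurable_sum => m; exact: mU2.
- by move=> x _; rewrite -EFinM lee_fin mulr_ge0 ?sqr_ge0.
- exact: measurable_funeM.
have [Z [mZ Z0 hZ]] := frobsq_Phi_le.
exists Z; split=> // x /= h; apply: hZ => /= h'.
apply: h => /h' le.
under eq_bigr do rewrite sumEFin; rewrite sumEFin -EFinM lee_fin.
under eq_bigr do rewrite -mulr_sumr.
by rewrite -mulr_sumr mulrC ler_wpM2r// sqr_ge0.
Qed.

(** On the Fourier side the combination of displacements is multiplication of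
    Phi by a trigonometric polynomial, whose L^2 norm is the l^2 norm of the
    coefficients c because the exponentials of frequency 2 N s are
    orthonormal. *)
Lemma synthesis_bound c B S : [set` B] `<=` Lambda N r ->
  [set` S] `<=` Lambda N r ->
  \sum_(l <- B) frobsq (\sum_(s <- S) c s *: displacement N s phi l) <=
  eps ^+ 2 * \sum_(s <- S) cmod (c s) ^+ 2.
Proof.
move=> BL SL; set T := \sum_(s <- S) _.
have T0 : 0 <= T by apply: sumr_ge0 => s _; exact: sqr_ge0.
have eT0 : 0 <= eps ^+ 2 * T by rewrite mulr_ge0 ?sqr_ge0.
apply: (@le_of_le_eps _ _ _ (eps ^+ 2 * T + 1)); first by rewrite addr_ge0.
move=> t t0.
pose M := \sum_(s <- S) cmod (c s).
pose c' l := c (l / (2 * N%:R)).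
have N0 : 2 * N%:R != 0 :> R by rewrite mulf_neq0 ?pnatr_eq0// -lt0n.
have hM x : cmod (trigpoly c' (scaled S) x) <= M.
  rewrite -scaled_trigpoly; apply: le_trans (le_cmod_sum _ _) _.
  by apply: ler_sum => s _; rewrite cmodM cmod_cexp2pi mulr1.
have eT : \sum_(l <- scaled S) cmod (c' l) ^+ 2 = T.
  rewrite /scaled big_imfset/=; last by move=> u v _ _ /(mulfI N0).
  by apply: eq_bigr => s _; rewrite /c' [_ * s]mulrC mulfK.
(* K collects the factors that multiply the squared approximation error in
   the n^2 entries; an error of t / (K + 1) per entry then costs at most t. *)
pose K := (1 + t^-1) * M ^+ 2 * (n%:R * n%:R).
have K0 : 0 <= K.
  have t3 : 0 <= 1 + t^-1 by rewrite addr_ge0// invr_ge0 ltW.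
  exact: mulr_ge0 (mulr_ge0 t3 (sqr_ge0 _)) (mulr_ge0 (ler0n _ _) (ler0n _ _)).
have K1 : 0 < K + 1 by rewrite ltr_wpDl.
have d0 : 0 < t / (K + 1) by rewrite divr_gt0.
(* The combination at l in B only involves phi at the points of B1. *)
pose B1 := [fset (l - 2 * N%:R * s)%R | l in B, s in S]%fset.
have B1L : [set` B1] `<=` Lambda N r.
  move=> _ /= /imfset2P[/= l lB [s sS ->]].
  by apply: Lambda_subN; [|exact: BL|exact: SL].
have [A [AL B1A hA]] := fourier_approx d0 B1L.
have inA l s : l \in B -> s \in S -> l - 2 * N%:R * s \in A.
  move=> lB sS; apply: (fsubsetP B1A); apply/imfset2P.
  by exists l => //; exists s.
have -> : \sum_(l <- B) frobsq (\sum_(s <- S) c s *: displacement N s phi l) =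
    \sum_(m < n) \sum_(k < n) \sum_(l <- B) cmod (\sum_(s <- S) c s *
      (if l - 2 * N%:R * s \in A then phi (l - 2 * N%:R * s) m k else 0)) ^+ 2.
  rewrite exchange_big/=; under [RHS]eq_bigr do rewrite exchange_big/=.
  rewrite [RHS]exchange_big/= exchange_big/= big_seq [RHS]big_seq.
  apply: eq_bigr => l lB; rewrite /frobsq; apply: eq_bigr => m _.
  apply: eq_bigr => k _; rewrite summxE; congr (cmod _ ^+ 2).
  by rewrite big_seq [RHS]big_seq; apply: eq_bigr => s sS; rewrite mxE inA.
rewrite -lee_fin -sumEFin.
under eq_bigr do rewrite -sumEFin.
apply: (@le_trans _ _ (\sum_(m < n) \sum_(k < n)
  ((1 + t)%:E * \int[mu]_(x in Omega)
      (cmod (trigpoly c' (scaled S) x) ^+ 2 * cmod (Phi x m k) ^+ 2)%:E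
   + ((1 + t^-1) * M ^+ 2 * (t / (K + 1)))%:E))%E).
  apply: lee_sum => m _; apply: lee_sum => k _.
  have conv := convolution_bessel N_gt0 r_odd c (fun l => phi l m k) AL BL SL.
  apply: le_trans conv _.
  under eq_integral do rewrite scaled_trigpoly.
  exact: multiplier_approx (cmeasurable_fourier m k) t0 hM (hA m k).
have I0 m k : (0 <= \int[mu]_(x in Omega)
      (cmod (trigpoly c' (scaled S) x) ^+ 2 * cmod (Phi x m k) ^+ 2)%:E)%E.
  by apply: integral_ge0 => x _; rewrite lee_fin mulr_ge0 ?sqr_ge0.
under eq_bigr do rewrite big_split/= sumEFin -ge0_sume_distrr//.
rewrite big_split/= sumEFin -ge0_sume_distrr; last first.
  by move=> m _; exact: sume_ge0.
apply: (@le_trans _ _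
  ((1 + t)%:E * (eps ^+ 2 * T)%:E + (K * (t / (K + 1)))%:E)%E).
  apply: leeD.
    apply: lee_wpmul2l; first by rewrite lee_fin addr_ge0// ltW.
    by rewrite -eT; exact/integral_multiplier_le/scaled_Lambda.
  by rewrite lee_fin !sumr_const !card_ord -mulrnA -mulr_natr natrM /K mulrAC.
rewrite -EFinM -EFinD lee_fin.
suff : K * (t / (K + 1)) <= t by nra.
by rewrite mulrCA ger_pMr// ler_pdivrMr// mul1r lerDl.
Qed.

(** Duality: with c s the conjugates of the inner products themselves, the sum
    of their squares is the inner product of h with a combination of
    displacements, whose norm the synthesis bound controls. The inner products
    are replaced by finite subsums, at the cost of a vanishing error. *)
Lemma displacement_bessel_fset h S :
  square_summable N r phi -> square_summable N r h ->
  [set` S] `<=` Lambda N r ->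
  \sum_(s <- S) cmod (ell2_inner N r h (displacement N s phi)) ^+ 2 <=
  eps ^+ 2 * ell2_norm N r h ^+ 2.
Proof.
move=> sphi sh SL; pose c s := ell2_inner N r h (displacement N s phi).
rewrite -/(\sum_(s <- S) cmod (c s) ^+ 2); set T := \sum_(s <- S) _.
pose K := \sum_(s <- S) cmod (c s).
have K0 : 0 <= K by apply: sumr_ge0 => s _; exact: cmod_ge0.
apply: (@le_of_le_eps _ _ _ (2 * K)); first by rewrite mulr_ge0.
move=> t t0.
have /choice[F hF] : forall s, exists B, [set` B] `<=` Lambda N r /\
    (s \in S -> forall B', [set` B'] `<=` Lambda N r -> (B `<=` B')%fset ->
    cmod (c s - \sum_(l <- B') frobdot (h l) (displacement N s phi l)) <= t).
  move=> s; have [sS|sS] := boolP (s \in S); last first.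
    by exists fset0; split => // l /=; rewrite inE.
  have sd := square_summable_displacement N_gt0 (SL _ sS) sphi.
  have [B BL hB] := csum_approx (csummable_frobdot sh sd) t0.
  by exists B; split.
pose B := (\bigcup_(s <- S) F s)%fset.
have BL : [set` B] `<=` Lambda N r.
  by move=> l /= /bigfcupP[s _]; have [+ _] := hF s; exact.
pose d s := \sum_(l <- B) frobdot (h l) (displacement N s phi l).
have hd s : s \in S -> cmod (c s - d s) <= t.
  move=> sS; have [_] := hF s; apply=> //.
  by apply: bigfcup_sup.
have e1 : \sum_(s <- S) conjc (c s) * d s =
    \sum_(l <- B) frobdot (h l) (\sum_(s <- S) c s *: displacement N s phi l).
  under [RHS]eq_bigr do rewrite frobdot_sumZr.
  rewrite exchange_big/=; apply: eq_bigr => s _.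
  by rewrite mulr_sumr.
have e2 : complex.Re (\sum_(s <- S) conjc (c s) * d s) =
    T - complex.Re (\sum_(s <- S) conjc (c s) * (c s - d s)).
  apply/eqP; rewrite -[X in _ == X - _]addr0 eq_sym subr_eq addr0 -ReD.
  rewrite -big_split/= Re_sum; apply/eqP; apply: eq_bigr => s _.
  by rewrite -mulrDr addrC subrK mulrC mul_conjc.
have e3 : complex.Re (\sum_(s <- S) conjc (c s) * (c s - d s)) <= K * t.
  apply: le_trans (ler_norm _) _; apply: le_trans (le_abs_Re _) _.
  apply: le_trans (le_cmod_sum _ _) _.
  rewrite /K mulr_suml big_seq [leRHS]big_seq.
  apply: ler_sum => s sS; rewrite cmodM cmod_conjc.
  by rewrite ler_wpM2l ?cmod_ge0// hd.
have e4 : 2 * complex.Re (\sum_(s <- S) conjc (c s) * d s) <=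
    eps ^+ 2 * ell2_norm N r h ^+ 2 + T.
  rewrite e1 Re_sum mulr_sumr.
  have e20 : 0 < eps ^+ 2 by rewrite exprn_gt0.
  (* The weight eps^2 turns the synthesis bound eps^2 T into T, which the
     left-hand side, close to 2 T, absorbs. *)
  apply: le_trans (ler_sum _ (fun l _ => Re_frobdot_le _ _ e20)) _.
  rewrite big_split/= -!mulr_sumr; apply: lerD.
    by rewrite ler_wpM2l ?sqr_ge0// fset_sum_le_norm.
  rewrite mulrC ler_pdivrMr// mulrC; exact: synthesis_bound.
by rewrite e2 in e4; lra.
Qed.

Lemma displacement_bessel h :
  square_summable N r phi -> square_summable N r h ->
  (\esum_(s in Lambda N r)
     (cmod (ell2_inner N r h (displacement N s phi)) ^+ 2)%:E <=
   (eps ^+ 2 * ell2_norm N r h ^+ 2)%:E)%E.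
Proof.
move=> sphi sh; apply: esum_le_fset => S SL.
by rewrite lee_fin; exact: displacement_bessel_fset.
Qed.

End BoundedFourierTransform.

(** * Perturbation of frames *)

(** Minkowski's inequality for families of coefficients in its quadratic form;
    both sides may be infinite. *)
Lemma sum_esum_sqD_le (R : realType) (I : Type) (js : seq I) (D : set R)
    (u v : I -> R -> R[i]) (t : R) : 0 < t ->
  (\sum_(j <- js) \esum_(l in D) (cmod (u j l + v j l) ^+ 2)%:E <=
   (1 + t)%:E * \sum_(j <- js) \esum_(l in D) (cmod (u j l) ^+ 2)%:E +
   (1 + t^-1)%:E * \sum_(j <- js) \esum_(l in D) (cmod (v j l) ^+ 2)%:E)%E.
Proof.
move=> t0; have t1 : 0 <= 1 + t by rewrite addr_ge0// ltW.
have t2 : 0 <= 1 + t^-1 by rewrite addr_ge0// invr_ge0 ltW.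
have sq0 (w : I -> R -> R[i]) j :
    (0 <= \esum_(l in D) (cmod (w j l) ^+ 2)%:E)%E.
  by apply: esum_ge0 => l _; rewrite lee_fin sqr_ge0.
rewrite !ge0_sume_distrr// -big_split/=.
apply: lee_sum => j _; apply: esum_le_fset => A AD.
apply: (@le_trans _ _ ((1 + t)%:E * (\sum_(l <- A) cmod (u j l) ^+ 2)%:E +
   (1 + t^-1)%:E * (\sum_(l <- A) cmod (v j l) ^+ 2)%:E)%E).
  rewrite -!EFinM -EFinD lee_fin !mulr_sumr -big_split/=.
  by apply: ler_sum => l _; exact: cmodD_sq_le.
by apply: leeD; apply: lee_wpmul2l => //; exact: fset_sum_le_esum.
Qed.

Lemma leq_exp2_pred (p : nat) : (0 < p)%N -> (p <= 2 ^ (p - 1))%N.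
Proof. by case: p => // p _; rewrite subn1 /= ltn_expl. Qed.

(** With m the squared norm of the analysed vector, x^2 and y^2 the lower frame
    bound and the Bessel bound, and z the square sum of the perturbed
    coefficients: the parameter t = y / (x - y) turns the quadratic triangle
    inequality back into the sharp x |h| - y |h| <= sqrt z. *)
Lemma frame_lower_arith (R : realFieldType) (x y z m : R) : 0 < y -> y < x ->
  x ^+ 2 * m <= x / (x - y) * z + x / y * (y ^+ 2 * m) ->
  (x - y) ^+ 2 * m <= z.
Proof.
move=> y0 yx; have d0 : 0 < x - y by rewrite subr_gt0.
have x0 : 0 < x by exact: lt_trans yx.
rewrite (_ : x / y * (y ^+ 2 * m) = x * (y * m)); last by field; rewrite gt_eqF.
rewrite -mulrA expr2 -mulrA -mulrDr ler_pM2l// => le.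
have : (x - y) * m <= (x - y)^-1 * z by rewrite mulrBl lerBlDr.
by rewrite mulrC ler_pdivlMl// expr2 -!mulrA [m * _]mulrC.
Qed.

Theorem theorem3p1 (R : realType) (n N r p : nat)
  (n_gt0 : (0 < n)%N) (N_gt0 : (0 < N)%N)
  (r_odd : odd r) (r_coprime : coprime r N)
  (r_bounds : (1 <= r <= 2 * N - 1)%N)
  (p_gt0 : (0 < p)%N)
  (f : 'I_p -> R -> 'M[R[i]]_n) (a0 b0 : R)
  (f_ell2 : forall j, ell2 N r (f j))
  (f_neq0 : forall j, f j <> (fun=> 0))
  (f_frame : is_DFNS N r f a0 b0)
  (g : 'I_p -> R -> 'M[R[i]]_n) (eps : R)
  (g_ell2 : forall j, ell2 N r (g j))
  (g_neq0 : forall j, g j <> (fun=> 0))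
  (eps_gt0 : 0 < eps)
  (H : 'I_p -> R -> 'M[R[i]]_n)
  (H_fourier : forall j, is_fourier N r (fun l => f j l + g j l) (H j))
  (H_bound : forall j, {ae (@lebesgue_measure R),
     forall x, Omega N x -> mxnorm (H j x) <= eps})
  (eps_lt : eps < 2 ^+ (p - 1) * eps ^+ 2 * n%:R ^+ 2)
  (lt_a0 : 2 ^+ (p - 1) * eps ^+ 2 * n%:R ^+ 2 < a0) :
  is_DFNS N r g
    ((Num.sqrt a0 - Num.sqrt (2 ^+ (p - 1) * eps ^+ 2 * n%:R ^+ 2)) ^+ 2)
    (2 ^+ p * eps ^+ 2 * n%:R ^+ 2 + 2 * b0).
Proof.
have [a0_gt0 b0_gt0 frame] := f_frame.
pose B := 2 ^+ (p - 1) * eps ^+ 2 * n%:R ^+ 2; rewrite -/B in lt_a0 *.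
have B_gt0 : 0 < B by exact: lt_trans eps_lt.
have ra2 : Num.sqrt a0 ^+ 2 = a0 by rewrite sqr_sqrtr// ltW.
have rB2 : Num.sqrt B ^+ 2 = B by rewrite sqr_sqrtr// ltW.
have rB_gt0 : 0 < Num.sqrt B by rewrite sqrtr_gt0.
have rB_lt : Num.sqrt B < Num.sqrt a0 by rewrite ltr_sqrt.
have upperE : 2 ^+ p * eps ^+ 2 * n%:R ^+ 2 = 2 * B.
  by rewrite /B -[in 2 ^+ p](subnK p_gt0) addn1 exprS !mulrA.
have pB : p%:R * eps ^+ 2 <= B.
  rewrite /B mulrAC; apply: ler_wpM2r; first exact: sqr_ge0.
  rewrite -!natrX -natrM ler_nat.
  apply: leq_trans (leq_exp2_pred p_gt0) _.
  by rewrite leq_pmulr// expn_gt0 n_gt0.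
pose coef (F : 'I_p -> R -> 'M[R[i]]_n) h j l :=
  ell2_inner N r h (displacement N l (F j)).
pose phi j l := f j l + g j l.
pose sq (F : 'I_p -> R -> 'M[R[i]]_n) h :=
  (\sum_(j < p) \esum_(l in Lambda N r) (cmod (coef F h j l) ^+ 2)%:E)%E.
have sqphi h : ell2 N r h -> (sq phi h <= (B * ell2_norm N r h ^+ 2)%:E)%E.
  move=> hh; apply: (@le_trans _ _ (\sum_(j < p)
      (eps ^+ 2 * ell2_norm N r h ^+ 2)%:E)%E).
    apply: lee_sum => j _.
    apply: (displacement_bessel N_gt0 r_odd (H_fourier j) (H_bound j) eps_gt0).
      by apply: square_summableD; exact: ell2_square_summable.
    exact: ell2_square_summable.
  rewrite sumEFin lee_fin sumr_const card_ord -mulr_natl mulrA.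
  by rewrite ler_wpM2r// sqr_ge0.
have coefD h : ell2 N r h -> forall j l, Lambda N r l ->
    coef phi h j l = coef f h j l + coef g h j l.
  move=> hh j l Ll; rewrite -ell2_innerDr//.
  - exact: ell2_square_summable.
  - exact/(square_summable_displacement N_gt0 Ll)/ell2_square_summable.
  - exact/(square_summable_displacement N_gt0 Ll)/ell2_square_summable.
have sq_sub h (F G : 'I_p -> R -> 'M[R[i]]_n) t : 0 < t ->
    (forall j l, Lambda N r l ->
      coef phi h j l = coef F h j l + coef G h j l) ->
    (sq F h <= (1 + t)%:E * sq G h + (1 + t^-1)%:E * sq phi h)%E.
  move=> t0 e; have := sum_esum_sqD_le (index_enum 'I_p) (Lambda N r)
    (fun j l => - coef G h j l) (coef phi h) t0.
  congr (_ <= _ * _ + _)%E; apply: eq_bigr => j _; apply: eq_esum => l Ll.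
    by rewrite (e j l Ll) addrC addrK.
  by rewrite cmodN.
split.
- by rewrite exprn_gt0// subr_gt0.
- by rewrite upperE; lra.
move=> h hh; have [lo up] := frame h hh.
rewrite -/(sq f h) in lo up; rewrite -/(sq g h).
have H0 : 0 <= ell2_norm N r h ^+ 2 by exact: sqr_ge0.
have Y := sqphi h hh; have cD := coefD h hh; split.
  pose d := Num.sqrt a0 - Num.sqrt B.
  have d0 : 0 < d by rewrite subr_gt0.
  (* The parameter sqrt B / d makes the quadratic form of the triangle
     inequality an equality at the extremal norms. *)
  have t0 : 0 < Num.sqrt B / d by rewrite divr_gt0.
  have := sq_sub h f g _ t0 cD.
  have t1 : 0 <= 1 + (Num.sqrt B / d)^-1 by rewrite addr_ge0// invr_ge0 ltW.
  have sg0 : (0 <= sq g h)%E.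
    by apply: sume_ge0 => j _; apply: esum_ge0 => l _; rewrite lee_fin sqr_ge0.
  move: sg0; case: (sq g h) => [z|_ _|//]; last by rewrite leey.
  move=> _ le1; have := le_trans lo (le_trans le1
    (leeD2l _ (lee_wpmul2l _ Y))).
  rewrite -!EFinM -EFinD !lee_fin => /(_ t1).
  rewrite (_ : 1 + (Num.sqrt B / d)^-1 = Num.sqrt a0 / Num.sqrt B); last first.
    by rewrite /d; field; rewrite !gt_eqF.
  rewrite (_ : 1 + Num.sqrt B / d = Num.sqrt a0 / d); last first.
    by rewrite /d; field; rewrite !gt_eqF.
  have := @frame_lower_arith _ _ _ z (ell2_norm N r h ^+ 2) rB_gt0 rB_lt.
  by rewrite ra2 rB2.
have cD' j l : Lambda N r l -> coef phi h j l = coef g h j l + coef f h j l.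
  by move=> Ll; rewrite addrC cD.
apply: le_trans (sq_sub h g f 1 ltr01 cD') _.
rewrite invr1; have two : (0 <= (1 + 1 : R)%:E)%E by rewrite lee_fin.
apply: le_trans (leeD (lee_wpmul2l two up) (lee_wpmul2l two Y)) _.
by rewrite -!EFinM -EFinD lee_fin upperE; lra.
Qed.
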